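(* Let $f_1,f_2:\mathbb R^d\to\mathbb R$ be convex with $\nabla f_i$ globally Lipschitz continuous with modulus $L_i>0$ ($i=1,2$), let $f_3:\mathbb R^d\to\mathbb R\cup\{+\infty\}$ be proper and lower semicontinuous, and assume $\varphi:=f_1+f_2+f_3$ has a nonempty set of minimizers. Let $\lambda\in(0,2)$, $\underline\alpha:=\frac{2\lambda-3+\sqrt{9-4\lambda}}{2}$, $\alpha\in(\underline\alpha,1)$, and let $\gamma\in\Gamma$ with $\gamma\le\min\{\frac{\alpha}{L_1},\frac{1-\alpha}{L_2}\}$. Let $((x_1^k,x_2^k,x_3^k),(z_1^k,z_2^k))_k$ be any sequence generated by the relaxed Ryu splitting method. Then: (i) $x_i^{k+1}-x_i^k\to0$ for $i=1,2,3$, and $z_i^{k+1}-z_i^k\to0$ and $x_3^k-x_i^k\to0$ for $i=1,2$. If, in addition, $((x_1^k,x_2^k,x_3^k),(z_1^k,z_2^k))_k$ is bounded, then: (ii) for any cluster point $x^*$ of $(x_3^k)_k$, $\varphi_\gamma^{\mathrm{Ryu}}(z_1^k,z_2^k)\to\varphi(x^* )$ and $f_1(x_1^k)+f_2(x_2^k)+f_3(x_3^k)\to\varphi(x^* )$; (iii) the sets of cluster points of $(x_1^k)_k$, $(x_2^k)_k$, $(x_3^k)_k$ coincide, and every such cluster point $x^*$ is a critical point of $\varphi$, i.e. $0\in\nabla f_1(x^* )+\nabla f_2(x^* )+\partial f_3(x^* )$.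
   Context: For $h:\mathbb R^d\to\mathbb R\cup\{+\infty\}$ and $\gamma>0$, $\mathrm{prox}_{\gamma h}(z):=\operatorname{argmin}_{y}\{h(y)+\frac{1}{2\gamma}\|y-z\|^2\}$; $\partial f_3$ is the limiting subdifferential. The relaxed Ryu splitting method: given $z_1^0,z_2^0\in\mathbb R^d$, for $k\ge0$, $x_1^k=\mathrm{prox}_{\gamma f_1}(z_1^k)$, $x_2^k=\mathrm{prox}_{\frac{\gamma}{\alpha}f_2}(\frac{z_2^k}{\alpha}+x_1^k)$, $x_3^k\in\mathrm{prox}_{\gamma f_3}(x_1^k-z_1^k+x_2^k-z_2^k)$, $z_1^{k+1}=z_1^k+\lambda(x_3^k-x_1^k)$, $z_2^{k+1}=z_2^k+\lambda(x_3^k-x_2^k)$. Relaxed Ryu envelope: with $\gamma_1=\gamma/\alpha$, $\gamma_2=\gamma/(1-\alpha)$, and for $(z_1,z_2)$, $x_1=\mathrm{prox}_{\gamma f_1}(z_1)$, $x_2=\mathrm{prox}_{\frac{\gamma}{\alpha}f_2}(\frac{z_2}{\alpha}+x_1)$, $\varphi_\gamma^{\mathrm{Ryu}}(z_1,z_2):=\min_{y}\{f_3(y)+\sum_{i=1}^2[f_i(x_i)+\langle y-x_i,\nabla f_i(x_i)\rangle+\frac{1}{2\gamma_i}\|y-x_i\|^2]\}$. Stepsize set: fix $\epsilon_1\in\big(\frac{\alpha}{2\alpha-\lambda},\frac{2-\lambda}{1-\alpha}\big)$ and $\epsilon_2\in\big(\frac{\alpha L_2}{\lambda},+\infty\big)$,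 and set $\bar\gamma_0:=\frac{\lambda}{2L_1}$, $\bar\gamma_1:=\frac{\lambda}{2L_2}-\frac{\alpha}{2\epsilon_2}$, $\bar\gamma_2:=\frac{\alpha(2-\lambda-(1-\alpha)\epsilon_1)}{\alpha\epsilon_2+2(1-\alpha)L_1}$, $\bar\gamma_3:=\frac{(1-\alpha)(\epsilon_1(2\alpha-\lambda)-\alpha)}{2\alpha L_2\epsilon_1}$, and $\Gamma:=(0,\min\{\bar\gamma_0,\bar\gamma_1\}]\cap\big(0,\min\{\bar\gamma_2,\bar\gamma_3,\frac{1}{L_1+L_2}\}\big)$. *)

(* Defs.v *)
From HB Require Import structures.
From mathcomp Require Import all_boot all_order all_algebra.
From mathcomp Require Import all_classical all_reals all_analysis.
Set Implicit Arguments. Unset Strict Implicit. Unset Printing Implicit Defensive.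
Import Order.TTheory GRing.Theory Num.Theory.
Import numFieldNormedType.Exports.
Local Open Scope classical_set_scope.
Local Open Scope ring_scope.

Section Defs.
Variables (R : realType) (d : nat).
Notation V := 'rV[R]_d.

Definition dot (u v : V) : R := \sum_(i < d) u 0 i * v 0 i.
Definition enorm (u : V) : R := Num.sqrt (dot u u).

Definition convex_fun (f : V -> R) : Prop :=
  forall (x y : V) (t : R), 0 <= t -> t <= 1 ->
    f (t *: x + (1 - t) *: y) <= t * f x + (1 - t) * f y.

Definition is_gradient (f : V -> R) (g : V -> V) : Prop :=
  forall x : V, differentiable f x /\ forall h : V, 'd f x h = dot (g x) h.

Definition lipschitz_with (g : V -> V) (L : R) : Prop :=
  forall x y : V, enorm (g x - g y) <= L * enorm (x - y).

Definition proper_fun (f : V -> \bar R) : Prop :=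
  (forall x, f x != -oo%E) /\ (exists x, f x \is a fin_num).

Definition is_prox (h : V -> \bar R) (gamma : R) (z y : V) : Prop :=
  forall y' : V,
    (h y + (1 / (2 * gamma) * dot (y - z) (y - z))%:E <=
     h y' + (1 / (2 * gamma) * dot (y' - z) (y' - z))%:E)%E.

(* prox as a set (for possibly nonconvex h) *)
Definition prox_set (h : V -> \bar R) (gamma : R) (z : V) : set V :=
  [set y | is_prox h gamma z y].

(* prox as a function (single-valued for the convex smooth f1, f2) *)
Definition prox (h : V -> \bar R) (gamma : R) (z : V) : V :=
  xget 0 (prox_set h gamma z).

Definition fE (f : V -> R) : V -> \bar R := fun x => (f x)%:E.

Definition ryu_seq (f1 f2 : V -> R) (f3 : V -> \bar R) (gamma alpha lambda : R)
  (x1 x2 x3 z1 z2 : nat -> V) : Prop :=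
  forall k : nat,
    x1 k = prox (fE f1) gamma (z1 k) /\
    x2 k = prox (fE f2) (gamma / alpha) (alpha^-1 *: z2 k + x1 k) /\
    prox_set f3 gamma (x1 k - z1 k + x2 k - z2 k) (x3 k) /\
    z1 k.+1 = z1 k + lambda *: (x3 k - x1 k) /\
    z2 k.+1 = z2 k + lambda *: (x3 k - x2 k).

Definition ryu_envelope (f1 f2 : V -> R) (g1 g2 : V -> V) (f3 : V -> \bar R)
  (gamma alpha : R) (z1 z2 : V) : \bar R :=
  let x1 := prox (fE f1) gamma z1 in
  let x2 := prox (fE f2) (gamma / alpha) (alpha^-1 *: z2 + x1) in
  let gamma1 := gamma / alpha in
  let gamma2 := gamma / (1 - alpha) in
  ereal_inf [set (f3 y +
      (f1 x1 + dot (y - x1) (g1 x1) + 1 / (2 * gamma1) * dot (y - x1) (y - x1)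
     + (f2 x2 + dot (y - x2) (g2 x2) + 1 / (2 * gamma2) * dot (y - x2) (y - x2)))%:E)%E
    | y in [set: V]].

Definition frechet_subdiff (f : V -> \bar R) (x v : V) : Prop :=
  f x \is a fin_num /\
  forall eps : R, 0 < eps -> exists2 delta : R, 0 < delta &
    forall y : V, enorm (y - x) < delta ->
      (f x + (dot v (y - x) - eps * enorm (y - x))%:E <= f y)%E.

Definition limiting_subdiff (f : V -> \bar R) (x v : V) : Prop :=
  f x \is a fin_num /\
  exists (xs vs : nat -> V),
    xs @ \oo --> x /\ f \o xs @ \oo --> f x /\ vs @ \oo --> v /\
    forall k, frechet_subdiff f (xs k) (vs k).

Definition cluster_point (u : nat -> V) (x : V) : Prop :=
  exists phi : nat -> nat, {homo phi : m n / (m < n)%N >-> (m < n)%N} /\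
    (u \o phi) @ \oo --> x.

Definition bounded_seq (u : nat -> V) : Prop :=
  exists M : R, forall k, enorm (u k) <= M.

End Defs.

(* Main.v *)
Require Import Defs.
From HB Require Import structures.
From mathcomp Require Import all_boot all_order all_algebra.
From mathcomp Require Import all_classical all_reals all_analysis.
From mathcomp Require Import ring lra.
Set Implicit Arguments.
Unset Strict Implicit.
Unset Printing Implicit Defensive.
Import Order.TTheory GRing.Theory Num.Theory.
Import numFieldNormedType.Exports.
Local Open Scope classical_set_scope.
Local Open Scope ring_scope.

(* The optimality conditions of the two smooth prox steps turn the sum of the
   quadratic models of f1 and f2 into 1/(2 gamma) |y - (x1 - z1 + x2 - z2)|^2 up
   to a constant in y, so x3^k attains the minimum defining the envelope.
   Testing the envelope at step k+1 with y = x3^k and using the cocoercivity of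
   the gradients, together with
     lambda (x3 - x1) = D1 + gamma G1,
     lambda (x3 - x2) = gamma G2 + alpha (D2 - D1)
   (D_i, G_i the increments of x_i and of the gradient at x_i) and Young's
   inequality with weights eps1, eps2, the envelope decreases by at least
   c1 |D1|^2 + c2 |D2|^2 with c1, c2 > 0.  As gamma <= alpha / L1 and
   gamma <= (1 - alpha) / L2, the envelope dominates the objective at x3^k and is
   bounded below, so D1 and D2 vanish, and with them all residuals.  Along a
   convergent subsequence of x3, lower semicontinuity and the prox inequality
   tested at the limit identify the limit of f3 (x3^k), and
   (x1 - z1 + x2 - z2 - x3) / gamma is a Frechet subgradient of f3 at x3^k which
   converges to minus the gradient of f1 + f2. *)

(** * The Euclidean inner product and its link with the topology of row vectors *)

Section Dot.
Variables (R : realType) (d : nat).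
Implicit Types (u v w : 'rV[R]_d).

Lemma dotC u v : dot u v = dot v u.
Proof. by apply: eq_bigr => i _; rewrite mulrC. Qed.

Lemma dotDl u v w : dot (u + v) w = dot u w + dot v w.
Proof. by rewrite -big_split; apply: eq_bigr => i _; rewrite mxE mulrDl. Qed.

Lemma dotZl a u w : dot (a *: u) w = a * dot u w.
Proof. by rewrite /dot mulr_sumr; apply: eq_bigr => i _; rewrite mxE mulrA. Qed.

Lemma dotNl u w : dot (- u) w = - dot u w.
Proof. by rewrite -scaleN1r dotZl mulN1r. Qed.

Lemma dotDr u v w : dot w (u + v) = dot w u + dot w v.
Proof. by rewrite !(dotC w) dotDl. Qed.

Lemma dotZr a u w : dot w (a *: u) = a * dot w u.
Proof. by rewrite !(dotC w) dotZl. Qed.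

Lemma dotNr u w : dot w (- u) = - dot w u.
Proof. by rewrite !(dotC w) dotNl. Qed.

Lemma dot0l w : dot 0 w = 0.
Proof. by rewrite -(scale0r 0) dotZl mul0r. Qed.

Lemma dot0r w : dot w 0 = 0.
Proof. by rewrite dotC dot0l. Qed.

Definition dotE := (dotDl, dotDr, dotNl, dotNr, dotZl, dotZr).

Lemma dot_ge0 u : 0 <= dot u u.
Proof. by apply: sumr_ge0 => i _; exact: sqr_ge0. Qed.

Lemma sqr_enorm u : enorm u ^+ 2 = dot u u.
Proof. by rewrite sqr_sqrtr ?dot_ge0. Qed.

(** The ambient norm, which fixes the topology, is the sup norm; this comparison turns Euclidean
    estimates into convergence. *)
Lemma norm_le_enorm u : `|u| <= enorm u.
Proof.
rewrite [leLHS]mx_normrE; apply/bigmax_leP; split; first exact: sqrtr_ge0.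
move=> [i j] _ /=; rewrite (ord1 i) -sqrtr_sqr ler_wsqrtr// /dot (bigD1 j)//=.
by rewrite -expr2 lerDl sumr_ge0// => k _; exact: sqr_ge0.
Qed.

Lemma young u v (e : R) : 0 < e ->
  2 * dot u v <= e * dot u u + e^-1 * dot v v.
Proof.
move=> e0; rewrite -subr_ge0.
have -> : e * dot u u + e^-1 * dot v v - 2 * dot u v =
    e^-1 * dot (e *: u - v) (e *: u - v).
  by rewrite !dotE (dotC v u); field; rewrite gt_eqF.
by rewrite mulr_ge0 ?dot_ge0// invr_ge0 ltW.
Qed.

Lemma cvg_dot {T : Type} {F : set_system T} {FF : Filter F}
  (u v : T -> 'rV[R]_d) a b :
  u @ F --> a -> v @ F --> b -> (fun k => dot (u k) (v k)) @ F --> dot a b.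
Proof.
have cvg_coord (w : T -> 'rV[R]_d) (c : 'rV[R]_d) i :
    w @ F --> c -> w k 0 i @[k --> F] --> c 0 i.
  by move=> wc; exact: (@continuous_cvg _ _ _ _ _ w (fun x => x 0 i) c
    (@coord_continuous _ _ _ _ _ c) wc).
move=> ua vb; apply: cvg_big => [|i _]; first exact: add_continuous.
by apply: cvgM; exact: cvg_coord.
Qed.

Lemma cvg0_dot (u : nat -> 'rV[R]_d) :
  (fun k => dot (u k) (u k)) @ \oo --> (0 : R) -> u @ \oo --> (0 : 'rV[R]_d).
Proof.
move=> u0; apply: norm_cvg0.
apply: (@squeeze_cvgr _ _ _ _ (cst 0) (fun k => enorm (u k))).
- by near=> k; rewrite normr_ge0 norm_le_enorm.
- exact: cvg_cst.
- by rewrite -sqrtr0; exact: (continuous_cvg _ (@sqrt_continuous R 0) u0).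
Unshelve. all: by end_near. Qed.

Lemma dot_le0 u : dot u u <= 0 -> u = 0.
Proof.
move=> u0; apply/eqP; rewrite -normr_le0 (le_trans (norm_le_enorm u))//.
by rewrite /enorm ler0_sqrtr.
Qed.

Lemma cauchy_schwarz u v : dot u v ^+ 2 <= dot u u * dot v v.
Proof.
have [v0|v0] := leP (dot v v) 0.
  by rewrite (dot_le0 v0) !dot0r expr0n mulr0.
(* Multiplied by |v|^2, the gap is the squared length of |v|^2 times the component of [u] orthogonal
   to [v]. *)
rewrite -(ler_pM2l v0) -subr_ge0.
have -> : dot v v * (dot u u * dot v v) - dot v v * dot u v ^+ 2 =
    dot (dot v v *: u - dot u v *: v) (dot v v *: u - dot u v *: v).
  by rewrite !dotE (dotC v u); ring.
exact: dot_ge0.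
Qed.

Lemma cvg0_dot_bounded (u v : nat -> 'rV[R]_d) (M : R) :
  u @ \oo --> (0 : 'rV[R]_d) -> (forall k, dot (v k) (v k) <= M) ->
  (fun k => dot (u k) (v k)) @ \oo --> (0 : R).
Proof.
move=> u0 vM; apply: norm_cvg0.
apply: (@squeeze_cvgr _ _ _ _ (cst 0) (fun k => Num.sqrt (dot (u k) (u k) * M))).
- near=> k; rewrite normr_ge0 -sqrtr_sqr ler_wsqrtr//.
  by rewrite (le_trans (cauchy_schwarz _ _))// ler_wpM2l ?dot_ge0.
- exact: cvg_cst.
- have : dot (u k) (u k) * M @[k --> \oo] --> (0 : R).
    by rewrite -[0](mul0r M) -(dot0l (0 : 'rV[R]_d)); apply: cvgMr_tmp; exact: cvg_dot.
  by move=> uM; rewrite -sqrtr0; exact: (continuous_cvg _ (@sqrt_continuous R 0) uM).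
Unshelve. all: by end_near. Qed.

End Dot.

(** * Gradient inequalities for smooth and for convex functions *)

Section Smooth.
Variables (R : realType) (d : nat).
Implicit Types (f : 'rV[R]_d -> R) (g : 'rV[R]_d -> 'rV[R]_d) (x y v : 'rV[R]_d).

Lemma lipschitz_dot g (L : R) x y : 0 < L -> lipschitz_with g L ->
  dot (g x - g y) (g x - g y) <= L ^+ 2 * dot (x - y) (x - y).
Proof.
move=> L0 gL; rewrite -!sqr_enorm -exprMn ler_sqr ?gL// nnegrE.
- exact: sqrtr_ge0.
- by rewrite mulr_ge0 ?sqrtr_ge0// ltW.
Qed.

(** Young's inequality with weight [L] splits the product, and the Lipschitz bound absorbs the
    gradient term. *)
Lemma lipschitz_dotM g (L : R) x y : 0 < L -> lipschitz_with g L ->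
  dot (x - y) (g x - g y) <= L * dot (x - y) (x - y).
Proof.
move=> L0 gL; have := young (x - y) (g x - g y) L0.
have := lipschitz_dot x y L0 gL.
rewrite -(ler_pM2l (x := L^-1)) ?invr_gt0// mulrA expr2 mulKf ?gt_eqF//.
lra.
Qed.

Lemma gradient_continuous f g : is_gradient f g -> continuous f.
Proof. by move=> fg x; apply: differentiable_continuous; case: (fg x). Qed.

Lemma is_derive_line f g x v (t : R) : is_gradient f g ->
  is_derive t 1 (fun s : R => f (x + s *: v)) (dot (g (x + t *: v)) v).
Proof.
move=> fg; have [df dfE] := fg (x + t *: v).
have E : (fun h : R => h^-1 *: (((fun s => f (x + s *: v)) \o shift t) (h *: 1)
    - f (x + t *: v))) =
  (fun h => h^-1 *: ((f \o shift (x + t *: v)) (h *: v) - f (x + t *: v))).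
  apply/funext => h /=; congr (_ *: (f _ - _)).
  by rewrite [h *: 1]mulr1 scalerDl addrCA.
split.
- by rewrite /derivable E; exact: diff_derivable.
- by rewrite /derive E -dfE -deriveE.
Qed.

Lemma gradientN f g : is_gradient f g -> is_gradient (\- f) (\- g).
Proof.
move=> fg x; have [df dfE] := fg x; split; first exact: differentiableN.
move=> h; rewrite -deriveE; last exact: differentiableN.
rewrite (deriveN (f := f)); last exact: diff_derivable.
by rewrite deriveE// dfE dotNl.
Qed.

Lemma lipschitzN g (L : R) : lipschitz_with g L -> lipschitz_with (\- g) L.
Proof.
move=> gL x y; rewrite /= -opprD /enorm dotNl dotNr opprK; exact: gL.
Qed.

(** On the segment, [h] is [f] minus the linear and quadratic terms of the bound. Its slope [dh] is
    nonpositive inside, so the mean value theorem gives [h 1 <= h 0]. *)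
Lemma descent_lemma f g (L : R) x y : is_gradient f g -> 0 < L ->
  lipschitz_with g L ->
  f y <= f x + dot (g x) (y - x) + L / 2 * dot (y - x) (y - x).
Proof.
move=> fg L0 gL.
have -> : f y = f (x + 1 *: (y - x)) by rewrite scale1r addrC subrK.
move: (y - x) => v.
pose h (t : R) := f (x + t *: v) - (t * dot (g x) v + L / 2 * (t ^+ 2 * dot v v)).
pose dh (t : R) := dot (g (x + t *: v)) v - (dot (g x) v + L * (t * dot v v)).
have hd (t : R) : is_derive t 1 h (dh t).
  have ? := is_derive_line x v t fg.
  by rewrite /h /dh; apply: is_derive_eq; rewrite /GRing.scale /=; field.
have hc : {within `[0, 1], continuous h}.
  apply: continuous_subspaceT => t; apply: differentiable_continuous.
  exact/derivable1_diffP/ex_derive.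
have [c] := @MVT _ h dh 0 1 ltr01 (fun t _ => hd t) hc.
rewrite in_itv /= => /andP[c0 c1].
(* Multiplied by [c], the slope becomes the inner product of the increments of point and gradient
   between [x] and [x + c *: v], minus L |c v|^2. *)
have : dh c <= 0.
  have := lipschitz_dotM (x + c *: v) x L0 gL.
  rewrite (addrC x) addrK !dotE => H.
  rewrite /dh -(pmulr_rle0 _ c0); move: H; rewrite (addrC x) !(dotC (g _)); lra.
rewrite /h scale0r addr0; lra.
Qed.

Lemma ascent_lemma f g (L : R) x y : is_gradient f g -> 0 < L ->
  lipschitz_with g L ->
  f x + dot (g x) (y - x) - L / 2 * dot (y - x) (y - x) <= f y.
Proof.
move=> fg L0 gL; have := descent_lemma x y (gradientN fg) L0 (lipschitzN gL).
rewrite /= dotNl; lra.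
Qed.

(** Convexity at t y + (1 - t) x and the quadratic lower bound of [ascent_lemma], divided by [t],
    give the inequality up to an error linear in [t], which is then made small. *)
Lemma convex_gradient f g (L : R) x y : convex_fun f -> is_gradient f g ->
  0 < L -> lipschitz_with g L -> f x + dot (g x) (y - x) <= f y.
Proof.
move=> cf fg L0 gL; pose q := dot (y - x) (y - x).
have key (t : R) : 0 < t -> t <= 1 ->
    f x + dot (g x) (y - x) <= f y + t * (L / 2 * q).
  move=> t0 t1; have := cf y x t (ltW t0) t1.
  have := ascent_lemma x (t *: y + (1 - t) *: x) fg L0 gL.
  have -> : t *: y + (1 - t) *: x - x = t *: (y - x).
    by rewrite scalerBl scale1r scalerBr addrA addrAC addrK.
  rewrite dotZr dotZr dotZl -/q => A B; rewrite -(ler_pM2l t0); move: A B; lra.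
apply/ler_addgt0Pr => e e0.
have q0 : 0 <= L / 2 * q by rewrite mulr_ge0 ?divr_ge0 ?(ltW L0)//; exact: dot_ge0.
(* Chosen so that the error [t * (L / 2 * q)] is at most [e]; the added 1 keeps the denominator
   positive when [q] is 0. *)
pose t := Num.min 1 (e / (L / 2 * q + 1)).
have p0 : 0 < L / 2 * q + 1 by lra.
have t0 : 0 < t by rewrite lt_min ltr01 divr_gt0.
apply: (le_trans (key t t0 _)); first by rewrite ge_min lexx.
rewrite lerD2l; have : t <= e / (L / 2 * q + 1) by rewrite ge_min lexx orbT.
rewrite ler_pdivlMr//; nra.
Qed.

Lemma convex_cocoercive f g (L : R) x y : convex_fun f -> is_gradient f g ->
  0 < L -> lipschitz_with g L ->
  f x + dot (g x) (y - x) + 1 / (2 * L) * dot (g y - g x) (g y - g x) <= f y.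
Proof.
(* [z] minimizes the quadratic upper bound of [f - dot (g x)] at [y]. *)
move=> cf fg L0 gL; pose z := y - L^-1 *: (g y - g x).
have := convex_gradient x z cf fg L0 gL.
have := descent_lemma y z fg L0 gL.
have -> : z - y = - (L^-1 *: (g y - g x)) by rewrite /z addrAC subrr add0r.
have -> : z - x = (y - x) - L^-1 *: (g y - g x) by rewrite /z addrAC.
have : g y = g x + (g y - g x) by rewrite addrC subrK.
move: (g y - g x) (y - x) => G D ->; rewrite !dotE.
have -> : 1 / (2 * L) = L^-1 / 2 by field; rewrite gt_eqF.
have := mulKf (lt0r_neq0 L0) (L^-1 * dot G G); move: (L^-1) => c.
rewrite (mulrCA c); lra.
Qed.

End Smooth.

(** * Existence and stationarity of proximal points of smooth functions *)

Section Prox.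
Variables (R : realType) (d : nat).
Implicit Types (f : 'rV[R]_d -> R) (g : 'rV[R]_d -> 'rV[R]_d) (x y z : 'rV[R]_d).

(** The prox objective has gradient w / gamma at [p]; were [w] nonzero, a short step along -w would
    lower it. *)
Lemma is_prox_gradient f g (L gamma : R) z p : is_gradient f g -> 0 < L ->
  lipschitz_with g L -> 0 < gamma -> is_prox (fE f) gamma z p ->
  gamma *: g p = z - p.
Proof.
move=> fg L0 gL gamma0 zp.
pose w := gamma *: g p + (p - z).
suff : dot w w <= 0.
  by move/dot_le0/eqP; rewrite addr_eq0 opprB => /eqP.
(* [K] is the coefficient of |t w|^2 in the upper bound of the objective at [p - t *: w]; the step
   [t] below minimizes K t^2 |w|^2 - (t / gamma) |w|^2. *)
pose K := L / 2 + 1 / (2 * gamma).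
have K0 : 0 < K by rewrite addr_gt0 ?divr_gt0 ?mulr_gt0.
(* The prox inequality is tested at a gradient step [p - t w]. *)
pose t := (2 * gamma * K)^-1.
have t0 : 0 < t by rewrite invr_gt0 !mulr_gt0.
have := zp (p - t *: w); rewrite /fE -!EFinD lee_fin.
have := descent_lemma p (p - t *: w) fg L0 gL.
have -> : p - t *: w - p = - (t *: w) by rewrite addrAC subrr add0r.
have -> : p - t *: w - z = (p - z) - t *: w by rewrite addrAC.
have wE : dot w w = gamma * dot (g p) w + dot (p - z) w.
  by rewrite -dotZl -dotDl.
move: wE; move: (p - z) (g p) (f (p - t *: w)) => D G fw.
move: w => w wE; rewrite !dotE (dotC w D) => A B.
have {A B} : 0 <= - t * (dot G w + gamma^-1 * dot D w) + t * (K * t) * dot w w.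
  have -> : gamma^-1 = 2 * (1 / (2 * gamma)) by field; rewrite gt_eqF.
  by move: A B; rewrite /K; move: (1 / (2 * gamma)) => c; lra.
have -> : dot G w + gamma^-1 * dot D w = gamma^-1 * dot w w.
  by rewrite wE; field; rewrite gt_eqF.
have -> : K * t = gamma^-1 / 2 by rewrite /t; field; rewrite !gt_eqF.
have -> : - t * (gamma^-1 * dot w w) + t * (gamma^-1 / 2) * dot w w =
    - (t * gamma^-1 / 2) * dot w w by field; rewrite gt_eqF.
by rewrite mulNr oppr_ge0 pmulr_rle0// divr_gt0// divr_gt0.
Qed.

Lemma exists_prox f g (L gamma : R) z : convex_fun f -> is_gradient f g ->
  0 < L -> lipschitz_with g L -> 0 < gamma -> exists p, is_prox (fE f) gamma z p.
Proof.
move=> cf fg L0 gL gamma0.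
pose h y := f y + 1 / (2 * gamma) * dot (y - z) (y - z).
pose e y := 2 * gamma * dot (g z) (y - z) + dot (y - z) (y - z).
(* [A] is the ball centred at the gradient step [z - gamma (g z)] with [z] on
   its boundary; outside it the gradient inequality gives [h z < h y]. *)
pose A := [set y | e y <= 0].
have hA y : ~ A y -> h z <= h y.
  move=> /negP; rewrite -ltNge /h subrr dot0l mulr0 addr0 => ey.
  have := convex_gradient z y cf fg L0 gL.
  have : 0 < 1 / (2 * gamma) * e y by rewrite mulr_gt0// divr_gt0// mulr_gt0.
  have -> : 1 / (2 * gamma) * e y = dot (g z) (y - z) +
    1 / (2 * gamma) * dot (y - z) (y - z) by rewrite /e; field; rewrite gt_eqF.
  lra.
have subz_cont (y : 'rV[R]_d) : x - z @[x --> y] --> y - z.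
  exact: (@cvgB _ _ _ (nbhs y) _ id (cst z) y z (@cvg_id _ _) (cvg_cst _)).
have sq_cont (y : 'rV[R]_d) : dot (x - z) (x - z) @[x --> y] --> dot (y - z) (y - z).
  by apply: (@cvg_dot _ _ _ (nbhs y)); exact: subz_cont.
have Az : A z by rewrite /A /= /e subrr dot0r dot0l mulr0 addr0.
have cA : compact A.
  apply: bounded_closed_compact; last first.
    apply: (@closed_comp _ _ e [set r | r <= 0]); last exact: closed_le.
    move=> y _; apply: (@cvgD _ _ _ (nbhs y)); last exact: sq_cont.
    apply: (@cvgMl_tmp _ _ (nbhs y)); apply: (@cvg_dot _ _ _ (nbhs y)).
      exact: cvg_cst.
    exact: subz_cont.
  (* Completing the square, e y = |y - c|^2 - gamma^2 |g z|^2. *)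
  pose c := z - gamma *: g z.
  exists (gamma * enorm (g z) + `|c|); split; first exact: num_real.
  move=> r rM y Ay /=; apply: (le_trans _ (ltW rM)); rewrite -lerBlDr.
  rewrite (le_trans (lerB_dist _ _))// (le_trans (norm_le_enorm _))//.
  rewrite -ler_sqr ?nnegrE ?mulr_ge0 ?sqrtr_ge0 ?(ltW gamma0)//.
  rewrite exprMn !sqr_enorm.
  have -> : y - c = (y - z) + gamma *: g z by rewrite /c opprB addrCA addrC.
  move: Ay; rewrite /A /e /=; move: (y - z) => D.
  rewrite !dotE (dotC D); lra.
have [|p pA pmin] := @EVT_min_rV R d h A (ex_intro _ z Az) cA.
  apply: continuous_subspaceT => y; apply: (@cvgD _ _ _ (nbhs y)).
    exact: (gradient_continuous fg).
  by apply: (@cvgMl_tmp _ _ (nbhs y)); exact: sq_cont.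
exists p => y; rewrite /fE -!EFinD lee_fin -![_ + _ * _]/(h _).
have [Ay|nAy] := pselect (A y); first by apply: pmin; rewrite inE.
by rewrite (le_trans _ (hA _ nAy))// pmin// inE.
Qed.

(** [prox] falls back on 0 when no minimizer exists; existence ensures that the chosen point is a
    minimizer, hence stationary. *)
Lemma prox_gradient f g (L gamma : R) z : convex_fun f -> is_gradient f g ->
  0 < L -> lipschitz_with g L -> 0 < gamma ->
  gamma *: g (prox (fE f) gamma z) = z - prox (fE f) gamma z.
Proof.
move=> cf fg L0 gL gamma0; apply: (is_prox_gradient fg L0 gL gamma0).
exact: (xgetPex _ (exists_prox z cf fg L0 gL gamma0)).
Qed.

End Prox.

(** * The quadratic models that make up the envelope *)

Section Model.
Variables (R : realType) (d : nat).
Implicit Types (f : 'rV[R]_d -> R) (g : 'rV[R]_d -> 'rV[R]_d) (x y z : 'rV[R]_d).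

Definition prox_model f g (c : R) x y :=
  f x + dot (y - x) (g x) + 1 / (2 * c) * dot (y - x) (y - x).

(** The curvature 1 / c is at least [L], so the model dominates the bound of the descent lemma. *)
Lemma prox_model_ge f g (L c : R) x y : is_gradient f g -> 0 < L ->
  lipschitz_with g L -> 0 < c -> c * L <= 1 -> f y <= prox_model f g c x y.
Proof.
move=> fg L0 gL c0 cL; rewrite (le_trans (descent_lemma x y fg L0 gL))//.
rewrite /prox_model (dotC (g x)) lerD2l ler_wpM2r ?dot_ge0//.
by rewrite ler_pdivlMr ?mulr_gt0// (_ : L / 2 * (2 * c) = c * L)//; field.
Qed.

(** Cocoercivity, based at [x'] and evaluated at [x], is the only inequality used; the rest is an
    expansion in y - x, x' - x and the gradient increment. *)
Lemma prox_model_decrease f g (L c : R) x x' y :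
  convex_fun f -> is_gradient f g -> 0 < L -> lipschitz_with g L ->
  1 / (2 * L) * dot (g x' - g x) (g x' - g x) - dot (y - x) (g x' - g x)
    + 1 / c * dot (y - x) (x' - x) - 1 / (2 * c) * dot (x' - x) (x' - x)
  <= prox_model f g c x y - prox_model f g c x' y.
Proof.
move=> cf fg L0 gL; rewrite /prox_model.
have := convex_cocoercive x' x cf fg L0 gL.
have -> : g x - g x' = - (g x' - g x) by rewrite opprB.
have -> : x - x' = - (x' - x) by rewrite opprB.
have -> : y - x' = (y - x) - (x' - x) by rewrite opprB subrKA.
have : g x' = g x + (g x' - g x) by rewrite addrC subrK.
move: (g x') (g x) (y - x) (x' - x) (g x' - g x) => gx' gx r D G ->.
have -> : 1 / c = 2 * (1 / (2 * c)).
  by rewrite !div1r invfM mulVKf// pnatr_eq0.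
rewrite !dotE (dotC D r) (dotC D G) (dotC D gx).
move: (1 / (2 * c)) (1 / (2 * L)) => a b; lra.
Qed.

(** The curvatures alpha / gamma and (1 - alpha) / gamma add up to 1 / gamma, and [w] is the
    stationary point of the sum of the models. Hence the right-hand side is free of [y]. *)
Lemma ryu_model_shift (gamma alpha : R) (a b p q y w : 'rV[R]_d) : 0 < gamma ->
  alpha != 0 -> 1 - alpha != 0 ->
  w = alpha *: a + (1 - alpha) *: b - gamma *: p - gamma *: q ->
  dot (y - a) p + 1 / (2 * (gamma / alpha)) * dot (y - a) (y - a) +
    (dot (y - b) q + 1 / (2 * (gamma / (1 - alpha))) * dot (y - b) (y - b)) -
    1 / (2 * gamma) * dot (y - w) (y - w) =
  1 / (2 * (gamma / alpha)) * dot a a - dot a p +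
    (1 / (2 * (gamma / (1 - alpha))) * dot b b - dot b q) -
    1 / (2 * gamma) * dot w w.
Proof.
move=> gamma0 a0 a1 wE.
have yw : dot y w = alpha * dot y a + (1 - alpha) * dot y b -
    gamma * dot y p - gamma * dot y q by rewrite wE !dotE.
rewrite !dotE (dotC w y) (dotC a y) (dotC b y) yw.
by field; rewrite a0 a1 gt_eqF.
Qed.

End Model.

(** * Scalar inequalities behind the decrease of the envelope *)

Section Decrease.
Variable R : realType.

(** Since lambda^2 <= 2 lambda, (3 - lambda)^2 <= 9 - 4 lambda, so the lower bound on [alpha] is at
    least lambda / 2. *)
Lemma ryu_alpha_gt (lambda alpha : R) : 0 < lambda -> lambda < 2 ->
  (2 * lambda - 3 + Num.sqrt (9 - 4 * lambda)) / 2 < alpha ->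
  lambda < 2 * alpha.
Proof.
move=> l0 l2 ha.
suff : 3 - lambda <= Num.sqrt (9 - 4 * lambda) by lra.
rewrite -(ger0_norm (_ : 0 <= 3 - lambda)); last by lra.
rewrite -sqrtr_sqr ler_wsqrtr//; nra.
Qed.

(* The arguments are the Gram scalars of the increments [D_i] of [x_i], the
   increments [G_i] of the gradients at [x_i], and [r_i = x3 - x_i]; e.g. [D12]
   is [dot D_1 D_2] and [r1G1] is [dot r_1 G_1]. *)
Lemma ryu_scalar_decrease (lambda alpha gamma eps1 eps2 L1 L2 : R)
  (D11 D12 D22 G11 G22 D1G1 D2G2 D1G2 r1G1 r2G2 r1D1 r2D2 : R) :
  0 < lambda -> 0 < alpha -> alpha < 1 -> 0 < gamma -> 0 < eps1 -> 0 < eps2 ->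
  0 < L1 -> 0 < L2 ->
  gamma <= lambda / (2 * L1) ->
  gamma <= lambda / (2 * L2) - alpha / (2 * eps2) ->
  lambda * r1G1 = D1G1 + gamma * G11 ->
  lambda * r1D1 = D11 + gamma * D1G1 ->
  lambda * r2G2 = gamma * G22 + alpha * (D2G2 - D1G2) ->
  lambda * r2D2 = gamma * D2G2 + alpha * (D22 - D12) ->
  0 <= G11 -> 0 <= G22 -> D1G1 <= L1 * D11 -> 0 <= D2G2 -> D2G2 <= L2 * D22 ->
  - (2 * D1G2) <= eps2 * D11 + eps2^-1 * G22 ->
  2 * D12 <= eps1 * D11 + eps1^-1 * D22 ->
  (alpha * (2 - lambda - (1 - alpha) * eps1) -
     gamma * (alpha * eps2 + 2 * (1 - alpha) * L1)) * D11 +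
  ((1 - alpha) * (2 * alpha - lambda - alpha / eps1) -
     2 * alpha * gamma * L2) * D22 <=
  2 * lambda * gamma *
   ((1 / (2 * L1) * G11 - r1G1 + 1 / (gamma / alpha) * r1D1
     - 1 / (2 * (gamma / alpha)) * D11) +
    (1 / (2 * L2) * G22 - r2G2 + 1 / (gamma / (1 - alpha)) * r2D2
     - 1 / (2 * (gamma / (1 - alpha))) * D22)).
Proof.
move=> l0 a0 a1 g0 e10 e20 L10 L20 hg1 hg2 r1G r1D r2G r2D G1 G2 DG1 DG2p DG2 Y2 Y1.
have -> : 2 * lambda * gamma *
   ((1 / (2 * L1) * G11 - r1G1 + 1 / (gamma / alpha) * r1D1
     - 1 / (2 * (gamma / alpha)) * D11) +
    (1 / (2 * L2) * G22 - r2G2 + 1 / (gamma / (1 - alpha)) * r2D2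
     - 1 / (2 * (gamma / (1 - alpha))) * D22)) =
   2 * gamma * (lambda / (2 * L1) * G11) + 2 * gamma * (lambda / (2 * L2) * G22)
   - 2 * gamma * (lambda * r1G1) - 2 * gamma * (lambda * r2G2)
   + 2 * alpha * (lambda * r1D1) + 2 * (1 - alpha) * (lambda * r2D2)
   - lambda * alpha * D11 - lambda * (1 - alpha) * D22.
  by field; rewrite !gt_eqF// subr_gt0.
rewrite r1G r1D r2G r2D.
(* The two sides of the goal differ by exactly 2 (P1 + P2 + P3 + P4 + P5) + P6 + P7, where each
   label stands for the quantity shown nonnegative. *)
have P1 : 0 <= gamma * ((lambda / (2 * L1) - gamma) * G11).
  by rewrite !mulr_ge0 ?subr_ge0// ltW.
have P2 : 0 <= gamma * ((lambda / (2 * L2) - alpha / (2 * eps2) - gamma) * G22).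
  by rewrite !mulr_ge0 ?subr_ge0// ltW.
have E2 : alpha / (2 * eps2) = alpha * eps2^-1 / 2 by field; rewrite gt_eqF.
have P3 : 0 <= gamma * (1 - alpha) * (L1 * D11 - D1G1).
  by rewrite !mulr_ge0 ?subr_ge0// ltW.
have P4 : 0 <= gamma * alpha * (L2 * D22 - D2G2).
  by rewrite !mulr_ge0 ?subr_ge0// ltW.
have P5 : 0 <= gamma * (1 - alpha) * D2G2.
  by rewrite !mulr_ge0 ?subr_ge0// ltW.
have P6 : 0 <= gamma * alpha * (eps2 * D11 + eps2^-1 * G22 + 2 * D1G2).
  by rewrite mulr_ge0 ?(ltW (mulr_gt0 g0 a0))// -lerBlDr sub0r.
have P7 : 0 <= alpha * (1 - alpha) * (eps1 * D11 + eps1^-1 * D22 - 2 * D12).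
  by rewrite !mulr_ge0 ?subr_ge0// ltW.
move: P2; rewrite E2; move: P1 P3 P4 P5 P6 P7.
move: (lambda / (2 * L1)) (lambda / (2 * L2)) (eps1^-1) (eps2^-1) => c1 c2 i1 i2.
lra.
Qed.

End Decrease.

(** * Convergence of sequences and subsequences *)

Section Sequences.
Variables (R : realType) (d : nat).
Implicit Types (u v : nat -> 'rV[R]_d) (x : 'rV[R]_d) (g : 'rV[R]_d -> 'rV[R]_d).

Lemma cvg_homo_ltn (phi : nat -> nat) :
  {homo phi : m n / (m < n)%N >-> (m < n)%N} -> phi @ \oo --> \oo.
Proof.
move=> phiS; have le_phi n : (n <= phi n)%N.
  by elim: n => // n IHn; rewrite (leq_ltn_trans IHn)// phiS.
move=> A [N _ NA]; exists N => // n /= Nn; apply: NA => /=.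
exact: leq_trans Nn (le_phi n).
Qed.

Lemma cvg_subseq (T : topologicalType) (a : nat -> T) (l : T) (phi : nat -> nat) :
  {homo phi : m n / (m < n)%N >-> (m < n)%N} ->
  a @ \oo --> l -> (a \o phi) @ \oo --> l.
Proof. by move=> /cvg_homo_ltn phioo; exact: cvg_comp. Qed.

Lemma cvg0_lipschitz g (L : R) u v : 0 < L -> lipschitz_with g L ->
  (fun k => u k - v k) @ \oo --> (0 : 'rV[R]_d) ->
  (fun k => g (u k) - g (v k)) @ \oo --> (0 : 'rV[R]_d).
Proof.
move=> L0 gL uv; apply: cvg0_dot.
apply: (@squeeze_cvgr _ _ _ _ (cst 0)
  (fun k => L ^+ 2 * dot (u k - v k) (u k - v k))).
- by near=> k; rewrite dot_ge0 lipschitz_dot.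
- exact: cvg_cst.
- rewrite -[0](mulr0 (L ^+ 2)) -(dot0l (0 : 'rV[R]_d)).
  by apply: cvgMl_tmp; exact: cvg_dot.
Unshelve. all: by end_near. Qed.

Lemma cvg_lipschitz g (L : R) u x : 0 < L -> lipschitz_with g L ->
  u @ \oo --> x -> (fun k => g (u k)) @ \oo --> g x.
Proof.
move=> L0 gL /subr_cvg0 ux; apply/subr_cvg0.
exact: (cvg0_lipschitz (v := fun=> x) L0 gL ux).
Qed.

Lemma lipschitz_bounded g (L M : R) u : 0 < L -> lipschitz_with g L ->
  (forall k, enorm (u k) <= M) ->
  forall k, dot (g (u k)) (g (u k)) <= 2 * (L ^+ 2 * M ^+ 2) + 2 * dot (g 0) (g 0).
Proof.
move=> L0 gL uM k; have := lipschitz_dot (u k) 0 L0 gL; rewrite subr0.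
have : L ^+ 2 * dot (u k) (u k) <= L ^+ 2 * M ^+ 2.
  rewrite ler_wpM2l ?sqr_ge0// -sqr_enorm ler_sqr ?nnegrE ?sqrtr_ge0//.
  exact: le_trans (sqrtr_ge0 _) (uM k).
(* This square is the gap in |a|^2 <= 2 |a - b|^2 + 2 |b|^2 with a = g (u k) and b = g 0. *)
have := dot_ge0 (g (u k) - 2 *: g 0).
rewrite !dotE (dotC (g 0)); lra.
Qed.

Lemma cluster_point_sub u v x :
  (fun k => u k - v k) @ \oo --> (0 : 'rV[R]_d) ->
  cluster_point u x <-> cluster_point v x.
Proof.
move=> uv; split=> -[phi [phiS cvgx]]; exists phi; split=> //.
- apply: (cvg_sub0 _ cvgx); rewrite -oppr0.
  rewrite (_ : _ - _ = - ((fun k => u k - v k) \o phi)); last first.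
    by apply/funext => k; rewrite -[RHS]/(- (_ - _)) opprB.
  by apply: cvgN; exact: (cvg_subseq phiS uv).
- by apply: (cvg_sub0 _ cvgx); exact: (cvg_subseq phiS uv).
Qed.

Lemma lsc_cvg_le (f : 'rV[R]_d -> \bar R) u (r : nat -> R) x (l : R) :
  lower_semicontinuous f -> u @ \oo --> x -> (forall k, f (u k) = (r k)%:E) ->
  r @ \oo --> l -> (f x <= l%:E)%E.
Proof.
move=> lf ux fr rl; rewrite leNgt; apply/negP => lfx.
have [a la afx] : exists2 a : R, l < a & (a%:E < f x)%E.
  case: (f x) lfx => [s| |]//; last by exists (l + 1); rewrite ?ltry// ltrDl.
  by rewrite lte_fin => ls; exists ((l + s) / 2); rewrite ?lte_fin; lra.
have [V xV Va] := lf _ _ afx.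
have : a <= l.
  apply: (ler_cvg_to (cvg_cst a) rl); near=> k.
  rewrite -lee_fin -fr ltW//; apply: Va; near: k; exact: ux.
by rewrite leNgt la.
Unshelve. all: by end_near. Qed.

(** [e] is nonincreasing and bounded below, so it converges and its increments, which control [a],
    vanish. *)
Lemma cvg0_of_decrease (e a : nat -> R) (C K m : R) : 0 < C -> 0 < K ->
  (forall k, 0 <= a k) -> (forall k, C * a k <= K * (e k - e k.+1)) ->
  (forall k, m <= e k) -> cvgn e /\ a @ \oo --> (0 : R).
Proof.
move=> C0 K0 a0 ae me.
have eS k : e k.+1 <= e k.
  have : 0 <= K * (e k - e k.+1) by apply: le_trans (ae k); rewrite mulr_ge0// ltW.
  by rewrite pmulr_rge0// subr_ge0.
have ce : cvgn e.
  apply: nonincreasing_is_cvgn; first exact/nonincreasing_seqP.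
  by exists m => _ [k _ <-].
split=> //.
apply: (@squeeze_cvgr _ _ _ _ (cst 0) (fun k => K / C * (e k - e k.+1))).
- near=> k; rewrite a0 mulrAC ler_pdivlMr// mulrC; exact: ae.
- exact: cvg_cst.
- rewrite -[0](mulr0 (K / C)) -(subrr (limn e)).
  by apply: cvgMl_tmp; apply: cvgB => //; rewrite cvg_shiftS.
Unshelve. all: by end_near. Qed.

End Sequences.

(** * The Ryu iteration and the values of its envelope *)

Section RyuEnvelope.
Variables (R : realType) (d : nat).
Variables (f1 f2 : 'rV[R]_d -> R) (g1 g2 : 'rV[R]_d -> 'rV[R]_d).
Variables (f3 : 'rV[R]_d -> \bar R) (L1 L2 lambda alpha gamma : R).
Variables (x1 x2 x3 z1 z2 : nat -> 'rV[R]_d).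
Hypotheses (cf1 : convex_fun f1) (cf2 : convex_fun f2).
Hypotheses (fg1 : is_gradient f1 g1) (fg2 : is_gradient f2 g2).
Hypotheses (L10 : 0 < L1) (L20 : 0 < L2).
Hypotheses (gL1 : lipschitz_with g1 L1) (gL2 : lipschitz_with g2 L2).
Hypothesis (pf3 : proper_fun f3).
Hypotheses (alpha0 : 0 < alpha) (alpha1 : alpha < 1) (gamma0 : 0 < gamma).
Hypothesis ryu : ryu_seq f1 f2 f3 gamma alpha lambda x1 x2 x3 z1 z2.

Lemma ryu_prox1 k : gamma *: g1 (x1 k) = z1 k - x1 k.
Proof. by have [-> _] := ryu k; exact: prox_gradient cf1 fg1 L10 gL1 gamma0. Qed.

Lemma ryu_prox2 k : gamma *: g2 (x2 k) = z2 k - alpha *: (x2 k - x1 k).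
Proof.
have [_ [x2E _]] := ryu k.
have := prox_gradient (alpha^-1 *: z2 k + x1 k) cf2 fg2 L20 gL2 (divr_gt0 gamma0 alpha0).
rewrite -x2E => /(congr1 (fun v => alpha *: v)).
rewrite scalerA mulrC divfK ?gt_eqF// => ->.
apply/rowP => i; rewrite !mxE; field.
by rewrite gt_eqF.
Qed.

Lemma ryu_residual1 k :
  lambda *: (x3 k - x1 k) = (x1 k.+1 - x1 k) + gamma *: (g1 (x1 k.+1) - g1 (x1 k)).
Proof.
have [_ [_ [_ [z1S _]]]] := ryu k.
rewrite (scalerBr gamma) !ryu_prox1 z1S.
by apply/rowP => i; rewrite !mxE; ring.
Qed.

Lemma ryu_residual2 k :
  lambda *: (x3 k - x2 k) = gamma *: (g2 (x2 k.+1) - g2 (x2 k)) +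
    alpha *: ((x2 k.+1 - x2 k) - (x1 k.+1 - x1 k)).
Proof.
have [_ [_ [_ [_ z2S]]]] := ryu k.
rewrite (scalerBr gamma) !ryu_prox2 z2S.
by apply/rowP => i; rewrite !mxE; ring.
Qed.

Definition ryu_center k := x1 k - z1 k + x2 k - z2 k.

(** Eliminating [z1] and [z2] gives the form required by [ryu_model_shift], and makes the center a
    continuous function of [x1 k] and [x2 k]. *)
Lemma ryu_centerE k : ryu_center k =
  alpha *: x1 k + (1 - alpha) *: x2 k - gamma *: g1 (x1 k) - gamma *: g2 (x2 k).
Proof.
by rewrite ryu_prox1 ryu_prox2; apply/rowP => i; rewrite !mxE; ring.
Qed.

Definition ryu_model k y :=
  prox_model f1 g1 (gamma / alpha) (x1 k) y +
  prox_model f2 g2 (gamma / (1 - alpha)) (x2 k) y.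

(** The constant of [ryu_model_shift] cancels, so minimizing [f3] plus the model is the prox problem
    solved by [x3 k]. *)
Lemma ryu_model_prox k y y' : ryu_model k y - ryu_model k y' =
  1 / (2 * gamma) * dot (y - ryu_center k) (y - ryu_center k) -
  1 / (2 * gamma) * dot (y' - ryu_center k) (y' - ryu_center k).
Proof.
have a0 : alpha != 0 by rewrite gt_eqF.
have a1 : 1 - alpha != 0 by rewrite gt_eqF// subr_gt0.
have := ryu_model_shift y gamma0 a0 a1 (ryu_centerE k).
have := ryu_model_shift y' gamma0 a0 a1 (ryu_centerE k).
rewrite /ryu_model /prox_model; lra.
Qed.

Lemma f3_fin_num k : f3 (x3 k) \is a fin_num.
Proof.
have [_ [_ [x3P _]]] := ryu k.
have [f3N [y0 fy0]] := pf3.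
have := x3P y0; rewrite -(fineK fy0) fin_numE f3N /=.
by case: (f3 (x3 k)).
Qed.

Definition f3_val k := fine (f3 (x3 k)).
Definition envelope_val k := f3_val k + ryu_model k (x3 k).

Lemma f3E k : f3 (x3 k) = (f3_val k)%:E.
Proof. by rewrite fineK ?f3_fin_num. Qed.

Lemma ryu_prox3 k y (r : R) : f3 y = r%:E ->
  f3_val k + 1 / (2 * gamma) * dot (x3 k - ryu_center k) (x3 k - ryu_center k) <=
  r + 1 / (2 * gamma) * dot (y - ryu_center k) (y - ryu_center k).
Proof.
move=> yr; have [_ [_ [x3P _]]] := ryu k.
by have := x3P y; rewrite f3E yr -!EFinD lee_fin.
Qed.

Lemma envelope_le k y (r : R) : f3 y = r%:E ->
  envelope_val k <= r + ryu_model k y.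
Proof.
move=> /(ryu_prox3 k); have := ryu_model_prox k y (x3 k).
rewrite /envelope_val; lra.
Qed.

Lemma ryu_envelopeE k :
  ryu_envelope f1 f2 g1 g2 f3 gamma alpha (z1 k) (z2 k) = (envelope_val k)%:E.
Proof.
rewrite /ryu_envelope; have [<- [<- _]] := ryu k.
apply/eqP; rewrite eq_le; apply/andP; split.
  by apply: ereal_inf_lbound; exists (x3 k) => //; rewrite f3E -EFinD.
apply: le_ereal_inf_tmp => _ [y _ <-].
case fy : (f3 y) => [r| |]; last by have := pf3.1 y; rewrite fy.
- by rewrite -EFinD lee_fin; exact: envelope_le.
- by rewrite addye// leey.
Qed.

Lemma envelope_ge k : gamma <= alpha / L1 -> gamma <= (1 - alpha) / L2 ->
  f1 (x3 k) + f2 (x3 k) + f3_val k <= envelope_val k.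
Proof.
rewrite !ler_pdivlMr// => h1 h2; rewrite /envelope_val addrC lerD2l.
apply: lerD.
- apply: (prox_model_ge _ _ fg1 L10 gL1); first by rewrite divr_gt0.
  by rewrite mulrAC ler_pdivrMr// mul1r.
- apply: (prox_model_ge _ _ fg2 L20 gL2); first by rewrite divr_gt0// subr_gt0.
  by rewrite mulrAC ler_pdivrMr ?subr_gt0// mul1r.
Qed.

Lemma envelope_decrease (eps1 eps2 : R) k :
  0 < lambda -> 0 < eps1 -> 0 < eps2 ->
  gamma <= lambda / (2 * L1) ->
  gamma <= lambda / (2 * L2) - alpha / (2 * eps2) ->
  (alpha * (2 - lambda - (1 - alpha) * eps1) -
     gamma * (alpha * eps2 + 2 * (1 - alpha) * L1)) *
    dot (x1 k.+1 - x1 k) (x1 k.+1 - x1 k) +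
  ((1 - alpha) * (2 * alpha - lambda - alpha / eps1) - 2 * alpha * gamma * L2) *
    dot (x2 k.+1 - x2 k) (x2 k.+1 - x2 k) <=
  2 * lambda * gamma * (envelope_val k - envelope_val k.+1).
Proof.
move=> l0 e10 e20 hg1 hg2.
pose D1 := x1 k.+1 - x1 k; pose D2 := x2 k.+1 - x2 k.
pose G1 := g1 (x1 k.+1) - g1 (x1 k); pose G2 := g2 (x2 k.+1) - g2 (x2 k).
pose r1 := x3 k - x1 k; pose r2 := x3 k - x2 k.
have r1E : lambda *: r1 = D1 + gamma *: G1 by exact: ryu_residual1.
have r2E : lambda *: r2 = gamma *: G2 + alpha *: (D2 - D1).
  exact: ryu_residual2.
have DG1 : dot D1 G1 <= L1 * dot D1 D1 by exact: lipschitz_dotM.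
have DG2 : dot D2 G2 <= L2 * dot D2 D2 by exact: lipschitz_dotM.
have DG2p : 0 <= dot D2 G2.
  have := convex_gradient (x2 k) (x2 k.+1) cf2 fg2 L20 gL2.
  have := convex_gradient (x2 k.+1) (x2 k) cf2 fg2 L20 gL2.
  by rewrite /D2 /G2 !dotE !(dotC (g2 _)); lra.
have Y1 := young D1 D2 e10.
(* The sign is flipped because the product of [D1] and [G2] must be bounded from below. *)
have := young (- D1) G2 e20; rewrite !dotNl dotNr opprK mulrN => Y2.
apply: (le_trans (@ryu_scalar_decrease R lambda alpha gamma eps1 eps2 L1 L2
  (dot D1 D1) (dot D1 D2) (dot D2 D2) (dot G1 G1) (dot G2 G2) (dot D1 G1)
  (dot D2 G2) (dot D1 G2) (dot r1 G1) (dot r2 G2) (dot r1 D1) (dot r2 D2)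
  l0 alpha0 alpha1 gamma0 e10 e20 L10 L20 hg1 hg2 _ _ _ _ (dot_ge0 _)
  (dot_ge0 _) DG1 DG2p DG2 Y2 Y1)).
- by rewrite -dotZl r1E dotDl dotZl.
- by rewrite -dotZl r1E dotDl dotZl (dotC G1).
- by rewrite -dotZl r2E (dotDl (gamma *: G2)) (dotZl gamma) (dotZl alpha)
    (dotDl D2) (dotNl D1).
- by rewrite -dotZl r2E (dotDl (gamma *: G2)) (dotZl gamma) (dotZl alpha)
    (dotDl D2) (dotNl D1) (dotC G2).
rewrite ler_wpM2l//; first by rewrite !mulr_ge0// ltW.
(* Testing at [x3 k] makes the values of [f3] cancel, leaving a difference of models at the same
   point. *)
have := envelope_le k.+1 (f3E k).
have := prox_model_decrease (gamma / alpha) (x1 k) (x1 k.+1) (x3 k) cf1 fg1 L10 gL1.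
have := prox_model_decrease (gamma / (1 - alpha)) (x2 k) (x2 k.+1) (x3 k) cf2 fg2 L20 gL2.
rewrite /envelope_val /ryu_model -/D1 -/D2 -/G1 -/G2 -/r1 -/r2; lra.
Qed.

(** * Vanishing residuals and limits of function values *)

Section Asymptotics.
Hypothesis lambda0 : 0 < lambda.
Hypothesis x1S : (fun k => x1 k.+1 - x1 k) @ \oo --> (0 : 'rV[R]_d).
Hypothesis x2S : (fun k => x2 k.+1 - x2 k) @ \oo --> (0 : 'rV[R]_d).

Lemma ryu_residual1_cvg0 : (fun k => x3 k - x1 k) @ \oo --> (0 : 'rV[R]_d).
Proof.
rewrite (_ : (fun k => _) = fun k => lambda^-1 *:
    ((x1 k.+1 - x1 k) + gamma *: (g1 (x1 k.+1) - g1 (x1 k)))); last first.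
  by apply/funext => k; rewrite -ryu_residual1 scalerK// gt_eqF.
rewrite -[0](scaler0 _ lambda^-1) -[0 in X in _ --> X](addr0 0).
rewrite -{2}[0](scaler0 _ gamma).
apply: cvgZl_tmp; apply: cvgD => //; apply: cvgZl_tmp.
exact: (cvg0_lipschitz L10 gL1 x1S).
Qed.

Lemma ryu_residual2_cvg0 : (fun k => x3 k - x2 k) @ \oo --> (0 : 'rV[R]_d).
Proof.
rewrite (_ : (fun k => _) = fun k => lambda^-1 *:
    (gamma *: (g2 (x2 k.+1) - g2 (x2 k)) +
     alpha *: ((x2 k.+1 - x2 k) - (x1 k.+1 - x1 k)))); last first.
  by apply/funext => k; rewrite -ryu_residual2 scalerK// gt_eqF.
have -> : (0 : 'rV[R]_d) = lambda^-1 *: (gamma *: 0 + alpha *: (0 - 0)).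
  by rewrite subrr !scaler0 addr0 scaler0.
apply: cvgZl_tmp; apply: cvgD; apply: cvgZl_tmp; last exact: cvgB.
exact: (cvg0_lipschitz L20 gL2 x2S).
Qed.

Lemma ryu_x3_increment_cvg0 : (fun k => x3 k.+1 - x3 k) @ \oo --> (0 : 'rV[R]_d).
Proof.
rewrite (_ : (fun k => _) = fun k => (x3 k.+1 - x1 k.+1) - (x3 k - x1 k) +
    (x1 k.+1 - x1 k)); last first.
  by apply/funext => k; apply/rowP => i; rewrite !mxE; ring.
have -> : (0 : 'rV[R]_d) = 0 - 0 + 0 by rewrite subrr addr0.
apply: cvgD => //; apply: cvgB; last exact: ryu_residual1_cvg0.
by rewrite (cvg_shiftS (fun k => x3 k - x1 k)); exact: ryu_residual1_cvg0.
Qed.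

Lemma ryu_z1_increment_cvg0 : (fun k => z1 k.+1 - z1 k) @ \oo --> (0 : 'rV[R]_d).
Proof.
rewrite (_ : (fun k => _) = fun k => lambda *: (x3 k - x1 k)); last first.
  by apply/funext => k; have [_ [_ [_ [-> _]]]] := ryu k; rewrite addrAC subrr add0r.
by rewrite -(scaler0 _ lambda); apply: cvgZl_tmp; exact: ryu_residual1_cvg0.
Qed.

Lemma ryu_z2_increment_cvg0 : (fun k => z2 k.+1 - z2 k) @ \oo --> (0 : 'rV[R]_d).
Proof.
rewrite (_ : (fun k => _) = fun k => lambda *: (x3 k - x2 k)); last first.
  by apply/funext => k; have [_ [_ [_ [_ ->]]]] := ryu k; rewrite addrAC subrr add0r.
by rewrite -(scaler0 _ lambda); apply: cvgZl_tmp; exact: ryu_residual2_cvg0.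
Qed.

Variable E : R.
Hypothesis envelope_cvg : envelope_val @ \oo --> E.
Hypotheses (bx1 : bounded_seq x1) (bx2 : bounded_seq x2).

Definition objective_val k := f1 (x1 k) + f2 (x2 k) + f3_val k.

(** Envelope and objective differ by two gaps, each a bounded gradient paired with a vanishing
    residual plus a multiple of the squared residual. *)
Lemma objective_cvg : objective_val @ \oo --> E.
Proof.
pose gap (g : 'rV[R]_d -> 'rV[R]_d) (c : R) (u : nat -> 'rV[R]_d) k :=
  dot (x3 k - u k) (g (u k)) + 1 / (2 * c) * dot (x3 k - u k) (x3 k - u k).
have gap0 g (L c : R) u : 0 < L -> lipschitz_with g L -> bounded_seq u ->
    (fun k => x3 k - u k) @ \oo --> (0 : 'rV[R]_d) -> gap g c u @ \oo --> (0 : R).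
  move=> L0 gL [M uM] xu; have -> : (0 : R) = 0 + 1 / (2 * c) * 0.
    by rewrite mulr0 addr0.
  apply: cvgD; first exact: (cvg0_dot_bounded xu (lipschitz_bounded L0 gL uM)).
  by apply: cvgMl_tmp; rewrite -(dot0l (0 : 'rV[R]_d)); exact: cvg_dot.
have gap1 := gap0 _ _ (gamma / alpha) _ L10 gL1 bx1 ryu_residual1_cvg0.
have gap2 := gap0 _ _ (gamma / (1 - alpha)) _ L20 gL2 bx2 ryu_residual2_cvg0.
have -> : objective_val = envelope_val -
    (gap g1 (gamma / alpha) x1 + gap g2 (gamma / (1 - alpha)) x2).
  apply/funext => k; rewrite -[RHS]/(_ - (_ + _)).
  by rewrite /objective_val /envelope_val /ryu_model /prox_model /gap; ring.
rewrite -[E]subr0 -[0 in X in _ --> X](addr0 0).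
by apply: cvgB => //; exact: cvgD.
Qed.

(** * Values and subgradients at a cluster point of [x3] *)

Section Cluster.
Variables (phi : nat -> nat) (xs : 'rV[R]_d).
Hypothesis phiS : {homo phi : m n / (m < n)%N >-> (m < n)%N}.
Hypothesis x3xs : (x3 \o phi) @ \oo --> xs.
Hypothesis lf3 : lower_semicontinuous f3.

Let sub_cvg (u : nat -> 'rV[R]_d) :
  (fun k => x3 k - u k) @ \oo --> (0 : 'rV[R]_d) -> (u \o phi) @ \oo --> xs.
Proof.
move=> xu; rewrite -[xs]subr0.
rewrite (_ : u \o phi = (x3 \o phi) - ((fun k => x3 k - u k) \o phi)); last first.
  by apply/funext => k /=; rewrite -[RHS]/(x3 (phi k) - (x3 (phi k) - u (phi k)));
    rewrite opprB addrC subrK.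
by apply: cvgB => //; exact: (cvg_subseq phiS xu).
Qed.

Let x1xs : (x1 \o phi) @ \oo --> xs := sub_cvg ryu_residual1_cvg0.
Let x2xs : (x2 \o phi) @ \oo --> xs := sub_cvg ryu_residual2_cvg0.

Let center_cvg : (ryu_center \o phi) @ \oo -->
  alpha *: xs + (1 - alpha) *: xs - gamma *: g1 xs - gamma *: g2 xs.
Proof.
rewrite (_ : _ \o _ = fun k => alpha *: x1 (phi k) + (1 - alpha) *: x2 (phi k) -
  gamma *: g1 (x1 (phi k)) - gamma *: g2 (x2 (phi k))); last first.
  by apply/funext => k /=; rewrite ryu_centerE.
apply: cvgB; last by apply: cvgZl_tmp; exact: (cvg_lipschitz L20 gL2 x2xs).
apply: cvgB; last by apply: cvgZl_tmp; exact: (cvg_lipschitz L10 gL1 x1xs).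
by apply: cvgD; apply: cvgZl_tmp.
Qed.

(** [f3] is only lower semicontinuous, so the limit is read off from the objective and the
    continuity of [f1] and [f2]. *)
Lemma f3_val_cvg : (f3_val \o phi) @ \oo --> E - f1 xs - f2 xs.
Proof.
rewrite (_ : f3_val \o phi = fun k => objective_val (phi k) -
    f1 (x1 (phi k)) - f2 (x2 (phi k))); last first.
  by apply/funext => k; rewrite /objective_val /=; ring.
apply: cvgB; last exact: (continuous_cvg _ (@gradient_continuous _ _ _ _ fg2 xs) x2xs).
apply: cvgB; last exact: (continuous_cvg _ (@gradient_continuous _ _ _ _ fg1 xs) x1xs).
exact: (cvg_subseq phiS objective_cvg).
Qed.

Lemma f3_cluster : f3 xs = (E - f1 xs - f2 xs)%:E.
Proof.
(* This bound also excludes the value +oo at [xs], so the prox inequality can be tested there for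
   the reverse bound. *)
have le_f3 := lsc_cvg_le lf3 x3xs (fun k => f3E (phi k)) f3_val_cvg.
case fxs : (f3 xs) le_f3 => [r| |]//; last by have := pf3.1 xs; rewrite fxs.
rewrite lee_fin => rE; congr (_%:E); apply/eqP; rewrite eq_le rE /=.
pose ws := alpha *: xs + (1 - alpha) *: xs - gamma *: g1 xs - gamma *: g2 xs.
rewrite -(lerD2r (1 / (2 * gamma) * dot (xs - ws) (xs - ws))).
have cvgl : (fun k => f3_val (phi k) + 1 / (2 * gamma) *
    dot (x3 (phi k) - ryu_center (phi k)) (x3 (phi k) - ryu_center (phi k)))
    @ \oo --> E - f1 xs - f2 xs + 1 / (2 * gamma) * dot (xs - ws) (xs - ws).
  apply: cvgD; first exact: f3_val_cvg.
  by apply: cvgMl_tmp; apply: cvg_dot; apply: cvgB => //; exact: center_cvg.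
have cvgr : (fun k => r + 1 / (2 * gamma) *
    dot (xs - ryu_center (phi k)) (xs - ryu_center (phi k)))
    @ \oo --> r + 1 / (2 * gamma) * dot (xs - ws) (xs - ws).
  apply: cvgD; first exact: cvg_cst.
  by apply: cvgMl_tmp; apply: cvg_dot; (apply: cvgB; [exact: cvg_cst|exact: center_cvg]).
by apply: (ler_cvg_to cvgl cvgr); near=> k; exact: ryu_prox3.
Unshelve. all: by end_near. Qed.

Lemma ryu_frechet_subdiff k :
  frechet_subdiff f3 (x3 k) (gamma^-1 *: (ryu_center k - x3 k)).
Proof.
split; first exact: f3_fin_num.
(* The prox inequality yields the subgradient inequality with error |y - x3|^2 / (2 gamma), which
   this radius makes at most e |y - x3|. *)
move=> e e0; exists (2 * gamma * e); first by rewrite !mulr_gt0.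
move=> y ylt.
case fy : (f3 y) => [r| |]; last by have := pf3.1 y; rewrite fy.
  rewrite f3E -EFinD lee_fin; have := ryu_prox3 k fy.
  have -> : y - ryu_center k = (y - x3 k) - (ryu_center k - x3 k).
    by rewrite (opprB (ryu_center k)) subrKA.
  rewrite -(opprB (ryu_center k)).
  have : dot (y - x3 k) (y - x3 k) <= 2 * gamma * e * enorm (y - x3 k).
    by rewrite -sqr_enorm expr2 ler_wpM2r ?sqrtr_ge0// ltW.
  move: (ryu_center k - x3 k) (y - x3 k) (enorm (y - x3 k)) => W D n.
  rewrite !dotE (dotC D W) => nD.
  have : 1 / (2 * gamma) * dot D D <= e * n.
    rewrite mul1r mulrC ler_pdivrMr ?mulr_gt0//.
    by rewrite (_ : e * n * (2 * gamma) = 2 * gamma * e * n)//; ring.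
  have -> : gamma^-1 = 2 * (1 / (2 * gamma)) by field; rewrite gt_eqF.
  move: (1 / (2 * gamma)) => c; lra.
by rewrite leey.
Qed.

Lemma cluster_critical : limiting_subdiff f3 xs (- (g1 xs + g2 xs)).
Proof.
split; first by rewrite f3_cluster.
exists (x3 \o phi), (fun k => gamma^-1 *: (ryu_center (phi k) - x3 (phi k))).
split=> //; split; last split.
- rewrite f3_cluster; apply/cvg_EFin.
    by near=> k; exact: f3_fin_num.
  exact: f3_val_cvg.
- have -> : - (g1 xs + g2 xs) = gamma^-1 *: (alpha *: xs + (1 - alpha) *: xs -
      gamma *: g1 xs - gamma *: g2 xs - xs).
    by apply/rowP => i; rewrite !mxE; field; rewrite gt_eqF.
  by apply: cvgZl_tmp; apply: cvgB => //; exact: center_cvg.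
- by move=> k; exact: ryu_frechet_subdiff.
Unshelve. all: by end_near. Qed.

End Cluster.
End Asymptotics.
End RyuEnvelope.

(** * Convergence of the relaxed Ryu splitting method *)

Unset Implicit Arguments.

Theorem theorem2 (R : realType) (d : nat)
  (f1 f2 : 'rV[R]_d -> R) (g1 g2 : 'rV[R]_d -> 'rV[R]_d)
  (f3 : 'rV[R]_d -> \bar R) (L1 L2 : R)
  (lambda alpha gamma eps1 eps2 : R)
  (x1 x2 x3 z1 z2 : nat -> 'rV[R]_d) :
  convex_fun f1 -> convex_fun f2 ->
  is_gradient f1 g1 -> is_gradient f2 g2 ->
  0 < L1 -> 0 < L2 -> lipschitz_with g1 L1 -> lipschitz_with g2 L2 ->
  proper_fun f3 -> lower_semicontinuous f3 ->
  (exists xm : 'rV[R]_d, forall y : 'rV[R]_d,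
     ((f1 xm + f2 xm)%:E + f3 xm <= (f1 y + f2 y)%:E + f3 y)%E) ->
  0 < lambda -> lambda < 2 ->
  (2 * lambda - 3 + Num.sqrt (9 - 4 * lambda)) / 2 < alpha -> alpha < 1 ->
  alpha / (2 * alpha - lambda) < eps1 -> eps1 < (2 - lambda) / (1 - alpha) ->
  alpha * L2 / lambda < eps2 ->
  (* gamma in Gamma *)
  0 < gamma ->
  gamma <= lambda / (2 * L1) ->
  gamma <= lambda / (2 * L2) - alpha / (2 * eps2) ->
  gamma < alpha * (2 - lambda - (1 - alpha) * eps1) / (alpha * eps2 + 2 * (1 - alpha) * L1) ->
  gamma < (1 - alpha) * (eps1 * (2 * alpha - lambda) - alpha) / (2 * alpha * L2 * eps1) ->
  gamma < 1 / (L1 + L2) ->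
  gamma <= alpha / L1 -> gamma <= (1 - alpha) / L2 ->
  ryu_seq f1 f2 f3 gamma alpha lambda x1 x2 x3 z1 z2 ->
  (* (i) *)
  ((fun k => x1 k.+1 - x1 k) @ \oo --> (0 : 'rV[R]_d) /\
   (fun k => x2 k.+1 - x2 k) @ \oo --> (0 : 'rV[R]_d) /\
   (fun k => x3 k.+1 - x3 k) @ \oo --> (0 : 'rV[R]_d) /\
   (fun k => z1 k.+1 - z1 k) @ \oo --> (0 : 'rV[R]_d) /\
   (fun k => z2 k.+1 - z2 k) @ \oo --> (0 : 'rV[R]_d) /\
   (fun k => x3 k - x1 k) @ \oo --> (0 : 'rV[R]_d) /\
   (fun k => x3 k - x2 k) @ \oo --> (0 : 'rV[R]_d)) /\
  ((bounded_seq x1 /\ bounded_seq x2 /\ bounded_seq x3 /\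
    bounded_seq z1 /\ bounded_seq z2) ->
   (* (ii) *)
   (forall xs : 'rV[R]_d, cluster_point x3 xs ->
      (fun k => ryu_envelope f1 f2 g1 g2 f3 gamma alpha (z1 k) (z2 k)) @ \oo
        --> ((f1 xs + f2 xs)%:E + f3 xs)%E /\
      (fun k => ((f1 (x1 k) + f2 (x2 k))%:E + f3 (x3 k))%E) @ \oo
        --> ((f1 xs + f2 xs)%:E + f3 xs)%E) /\
   (* (iii) *)
   (forall xs : 'rV[R]_d,
      (cluster_point x1 xs <-> cluster_point x2 xs) /\
      (cluster_point x2 xs <-> cluster_point x3 xs)) /\
   (forall xs : 'rV[R]_d, cluster_point x3 xs ->
      exists v : 'rV[R]_d, limiting_subdiff f3 xs v /\ g1 xs + g2 xs + v = 0)).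
Proof.
move=> cf1 cf2 fg1 fg2 L10 L20 gL1 gL2 pf3 lf3 [xm xm_min] lambda0 lambda2.
move=> alpha_gt alpha1 eps1_gt eps1_lt eps2_gt gamma0 hg0 hg1 hg2 hg3 _ hgL1 hgL2 ryu.
have lambda_lt := ryu_alpha_gt lambda0 lambda2 alpha_gt.
have alpha0 : 0 < alpha by lra.
have eps10 : 0 < eps1 by apply: lt_trans eps1_gt; rewrite divr_gt0// subr_gt0.
have eps20 : 0 < eps2 by apply: lt_trans eps2_gt; rewrite divr_gt0// mulr_gt0.
pose env := envelope_val f1 f2 g1 g2 f3 alpha gamma x1 x2 x3.
pose dec k := envelope_decrease cf1 cf2 fg1 fg2 L10 L20 gL1 gL2 pf3 alpha0 alpha1
  gamma0 ryu (eps1 := eps1) (eps2 := eps2) k lambda0 eps10 eps20 hg0 hg1.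
set C1 := alpha * _ - gamma * _ in dec.
set C2 := (1 - alpha) * _ - _ in dec.
have C10 : 0 < C1.
  move: hg2; rewrite ltr_pdivlMr ?subr_gt0//.
  by rewrite addr_gt0// !mulr_gt0// subr_gt0.
have C20 : 0 < C2.
  move: hg3; rewrite ltr_pdivlMr ?mulr_gt0// => hg3.
  (* Scaling by [eps1] recovers the numerator and denominator of the stepsize bound. *)
  rewrite /C2 -(pmulr_rgt0 _ eps10).
  have -> : eps1 * ((1 - alpha) * (2 * alpha - lambda - alpha / eps1) -
      2 * alpha * gamma * L2) =
    (1 - alpha) * (eps1 * (2 * alpha - lambda) - alpha) -
      gamma * (2 * alpha * L2 * eps1) by field; rewrite gt_eqF.
  by rewrite subr_gt0.
have K0 : 0 < 2 * lambda * gamma by rewrite !mulr_gt0.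
have [m env_ge] : exists m : R, forall k, m <= env k.
  have [_ [y0 fy0]] := pf3.
  have fxm : f3 xm \is a fin_num.
    by have := xm_min y0; rewrite -(fineK fy0) fin_numE pf3.1 /=; case: (f3 xm).
  (* The minimal objective value, finite by comparison with a point where [f3] is finite, bounds the
     envelope from below. *)
  exists (f1 xm + f2 xm + fine (f3 xm)) => k.
  apply: le_trans (envelope_ge f3 x1 x2 x3 fg1 fg2 L10 L20 gL1 gL2 alpha0 alpha1
    gamma0 k hgL1 hgL2).
  rewrite -lee_fin !EFinD /f3_val fineK// fineK; last exact: (f3_fin_num pf3 ryu k).
  by rewrite -!EFinD; exact: xm_min.
have dec1 k : C1 * dot (x1 k.+1 - x1 k) (x1 k.+1 - x1 k) <=
    2 * lambda * gamma * (env k - env k.+1).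
  by apply: le_trans (dec k); rewrite lerDl mulr_ge0 ?dot_ge0// ltW.
have dec2 k : C2 * dot (x2 k.+1 - x2 k) (x2 k.+1 - x2 k) <=
    2 * lambda * gamma * (env k - env k.+1).
  by apply: le_trans (dec k); rewrite lerDr mulr_ge0 ?dot_ge0// ltW.
have [env_cvg D1] := cvg0_of_decrease C10 K0 (fun k => dot_ge0 _) dec1 env_ge.
have [_ D2] := cvg0_of_decrease C20 K0 (fun k => dot_ge0 _) dec2 env_ge.
have {D1} x1S := cvg0_dot D1; have {D2} x2S := cvg0_dot D2.
have r1 := ryu_residual1_cvg0 cf1 fg1 L10 gL1 gamma0 ryu lambda0 x1S.
have r2 := ryu_residual2_cvg0 cf2 fg2 L20 gL2 alpha0 gamma0 ryu lambda0 x1S x2S.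
split.
  split; first exact: x1S.
  split; first exact: x2S.
  split; first exact: (ryu_x3_increment_cvg0 cf1 fg1 L10 gL1 gamma0 ryu lambda0 x1S).
  split; first exact: (ryu_z1_increment_cvg0 cf1 fg1 L10 gL1 gamma0 ryu lambda0 x1S).
  split; last by [].
  exact: (ryu_z2_increment_cvg0 cf2 fg2 L20 gL2 alpha0 gamma0 ryu lambda0 x1S x2S).
move=> [bx1 [bx2 _]].
have f3C xs phi phiS (x3xs : (x3 \o phi) @ \oo --> xs) :=
  f3_cluster cf1 cf2 fg1 fg2 L10 L20 gL1 gL2 pf3 alpha0 gamma0 ryu
    lambda0 x1S x2S env_cvg bx1 bx2 phiS x3xs lf3.
split; last split.
- move=> xs [phi [phiS x3xs]]; rewrite (f3C _ _ phiS x3xs) -EFinD.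
  (* The objective takes this same value at every cluster point. *)
  rewrite (_ : _ + _ + _ = limn env); last by ring.
  split.
  + under eq_fun do rewrite (ryu_envelopeE cf1 cf2 fg1 fg2 L10 L20 gL1 gL2 pf3
      alpha0 alpha1 gamma0 ryu).
    by apply: cvg_EFin => //; exact: nearW.
  + under eq_fun do rewrite (f3E pf3 ryu) -EFinD.
    apply: cvg_EFin; first exact: nearW.
    exact: (objective_cvg cf1 cf2 fg1 fg2 L10 L20 gL1 gL2 alpha0 gamma0 ryu
      lambda0 x1S x2S env_cvg bx1 bx2).
- move=> xs; have x32 := cluster_point_sub xs r2; have x31 := cluster_point_sub xs r1.
  by split; last exact: iff_sym; apply: iff_trans x32; exact: iff_sym.
- move=> xs [phi [phiS x3xs]]; exists (- (g1 xs + g2 xs)); split; last exact: subrr.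
  exact: (cluster_critical cf1 cf2 fg1 fg2 L10 L20 gL1 gL2 pf3 alpha0 gamma0
    ryu lambda0 x1S x2S env_cvg bx1 bx2 phiS x3xs lf3).
Qed.
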